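(* For every $k\ge3$ there exists an infinite family of graphs such that each graph $G$ in the family, with $n$ vertices, satisfies $\mathrm{ctdw}(G)=2k-1$ and has $\left((n-k)/(k-1)\right)^{k-1}$ connected sets $S\subseteq V(G)$ for which $\mathrm{tdw}_S(G)=2k-1$.
   Context: A strong tree decomposition of $G=(V,E)$ is $(\{X_i\}_{i\in I},T=(I,F))$ where $\{X_i\}$ partitions $V$ and $T$ is a tree such that each edge has both ends in one bag or in bags of two adjacent tree nodes; its width is the maximum bag size. A tree distance decomposition is a strong tree decomposition with root $r$ such that each $v\in X_i$, $i\neq r$, has a neighbor in the bag of the parent of $i$. For a vertex set $S$, there is a unique minimal (finest) tree distance decomposition with root bag $S$; $\mathrm{tdw}_S(G)$ is its width, and $\mathrm{tdw}_S(G)=\infty$ if no tree distance decomposition with root bag $S$ exists. A set $S$ is connected if it induces a connected subgraph. $\mathrm{ctdw}(G)$, the root-connected tree distance width, is the minimum width of a tree distance decomposition whose root bag induces a connected subgraph. *)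

(* Defs.v *)
From mathcomp Require Import all_boot.

Set Implicit Arguments.
Unset Strict Implicit.
Unset Printing Implicit Defensive.

Record sgraph := SGraph {
  vertex :> finType;
  adj : rel vertex;
  adj_sym : symmetric adj;
  adj_irrefl : irreflexive adj
}.
Arguments adj {s} : rename.

Definition isomorphic (G H : sgraph) : Prop :=
  exists2 f : G -> H, bijective f & forall x y, adj (f x) (f y) = adj x y.

(* The empty set is not connected. *)
Definition connected_set (G : sgraph) (S : {set G}) : bool :=
  (S != set0) &&
  [forall x in S, forall y in S,
     connect [rel u v | [&& u \in S, v \in S & adj u v]] x y].

(* [ucycle] also admits the back-and-forth walk along a single edge, of size 2;
   a cycle of the graph is one of size at least 3. *)
Definition acyclic (T : sgraph) : Prop :=
  forall c : seq T, ucycle adj c -> size c <= 2.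

Definition is_tree (T : sgraph) : Prop :=
  connected_set [set: T] /\ acyclic T.

(* [j] is the last but one node of the simple path from [r] to [i]; no such
   [j] exists when [i = r]. *)
Definition is_parent (T : sgraph) (r j i : T) : Prop :=
  exists p : seq T,
    [/\ path adj r (rcons p i), uniq (r :: rcons p i) & last r p = j].

(* [partition] requires the bags to be nonempty; with [bag_inj], distinct
   tree nodes have disjoint bags. *)
Record strong_tree_decomp (G : sgraph) := StrongTreeDecomp {
  td_tree : sgraph;
  td_treeP : is_tree td_tree;
  bag : td_tree -> {set G};
  bag_inj : injective bag;
  bag_partition : partition [set bag i | i : td_tree] [set: G];
  bag_edge : forall u v : G, adj u v ->
    exists i j : td_tree,
      [/\ u \in bag i, v \in bag j & (i == j) || adj i j]
}.
Arguments bag {G} s i : rename.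

Definition width (G : sgraph) (D : strong_tree_decomp G) : nat :=
  \max_(i : td_tree D) #|bag D i|.

Record tree_distance_decomp (G : sgraph) := TreeDistanceDecomp {
  tdd_std :> strong_tree_decomp G;
  root : td_tree tdd_std;
  bag_parent : forall (i j : td_tree tdd_std) (v : G),
    is_parent root j i -> v \in bag tdd_std i ->
    exists2 u : G, u \in bag tdd_std j & adj u v
}.
Arguments root {G} t : rename.

Definition root_bag (G : sgraph) (D : tree_distance_decomp G) : {set G} :=
  bag D (root D).

Definition finer (G : sgraph) (D D' : strong_tree_decomp G) : Prop :=
  forall i : td_tree D, exists j : td_tree D', bag D i \subset bag D' j.

Definition finest (G : sgraph) (D : tree_distance_decomp G) : Prop :=
  forall D' : tree_distance_decomp G, root_bag D' = root_bag D -> finer D D'.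

(* [is_tdw S w] reads tdw_S(G) = w, where [None] stands for infinity. *)
Inductive is_tdw (G : sgraph) (S : {set G}) : option nat -> Prop :=
| Tdw_finite (D : tree_distance_decomp G) :
    root_bag D = S -> finest D -> is_tdw S (Some (width D))
| Tdw_infinite :
    (forall D : tree_distance_decomp G, root_bag D <> S) -> is_tdw S None.

Lemma width_finer (G : sgraph) (D D' : strong_tree_decomp G) :
  finer D D' -> width D <= width D'.
Proof.
move=> h; apply/bigmax_leqP => i _; have [j /subset_leq_card s] := h i.
by apply: leq_trans s _; apply: (leq_bigmax j).
Qed.

Lemma is_tdw_inj (G : sgraph) (S : {set G}) (v w : option nat) :
  is_tdw S v -> is_tdw S w -> v = w.
Proof.
case=> [D r f|n]; case=> [D' r' f'|n'] //; try by [case: (n' D)|case: (n D')].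
congr Some; apply/eqP.
by rewrite eqn_leq !width_finer //; [apply: f'|apply: f]; congruence.
Qed.

(* [is_ctdw G w] reads ctdw(G) = w. *)
Definition is_ctdw (G : sgraph) (w : nat) : Prop :=
  (exists2 D : tree_distance_decomp G,
     connected_set (root_bag D) & width D = w) /\
  (forall D : tree_distance_decomp G,
     connected_set (root_bag D) -> w <= width D).

(* Main.v *)
Require Import Defs.
From mathcomp Require Import all_boot all_order all_algebra.
From mathcomp Require Import boolp.
From mathcomp Require Import zify.
Import GRing.Theory.

(** Take a chain of k vertices in which consecutive ones have m private common
    neighbours, with m at least 4k, so that n = k + (k - 1) m.  A connected set
    containing the whole chain meets each of the k - 1 layers, hence has at
    least 2k - 1 vertices; the m^(k-1) sets meeting each layer once reach this
    bound, and removing such a set leaves isolated vertices, whose bags are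
    singletons.  A connected root bag missing a chain vertex forces a bag of
    size at least m / 2: some layer lies between two nonadjacent bags, and its
    vertices outside the root bag share a bag because the tree contains no
    4-cycle.  If the root bag is a single layer vertex this layer is a
    neighbouring one, which exists because k >= 3. *)

Set Implicit Arguments.
Unset Strict Implicit.
Unset Printing Implicit Defensive.

(** * Stars as trees rooted at their centre *)

Section Star.
Variable I : finType.

Definition star_adj : rel (option I) := [rel a b | isSome a != isSome b].

Lemma star_adj_sym : symmetric star_adj.
Proof. by move=> a b; rewrite /star_adj /= eq_sym. Qed.

Lemma star_adj_irrefl : irreflexive star_adj.
Proof. by move=> a; rewrite /star_adj /= eqxx. Qed.

Definition star : sgraph := SGraph star_adj_sym star_adj_irrefl.

(** Adjacency alternates between the centre [None] and leaves, so a closed walk of length at least 3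
    meets [None] twice or closes up between two leaves. *)
Lemma star_tree : is_tree star.
Proof.
split.
  apply/andP; split; first by apply/set0Pn; exists (None : star).
  apply/forall_inP => x _; apply/forall_inP => y _.
  apply: (@connect_trans _ _ (None : star)).
    case: x => [x|]; last exact: connect0.
    by apply: connect1; rewrite /= !inE.
  case: y => [y|]; last exact: connect0.
  by apply: connect1; rewrite /= !inE.
case=> [|a [|b [|d s]]] //= /andP[cyc uniq_c]; exfalso.
move: cyc uniq_c; rewrite /star_adj /=.
case: a => [a|]; case: b => [b|]; case: d => [d|] //=;
  case: s => [|[e|] s] //=; rewrite !inE //= ?andbF //.
Qed.

Lemma star_parent (j i : star) : is_parent (None : star) j i -> i /\ ~~ j.
Proof.
case=> p [+ + <-]; case: p => [|a [|b p]] /=; rewrite /star_adj /=.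
- by case: i.
- by case: a => [a|] //=; case: i => [i|] //=; rewrite !inE.
- by case: a => [a|] //=; case: b => [b|] //=; rewrite !inE.
Qed.
End Star.

(** * Decompositions with a prescribed root bag and singleton leaves *)

Section StarDecomposition.
Variables (G : sgraph) (S : {set G}).
(** [S_cover] makes the complement of [S] independent, so its vertices can be separate leaves;
    [S_dom] gives each leaf a neighbour in the root bag. *)
Hypothesis S_neq0 : S != set0.
Hypothesis S_cover : forall u v : G, adj u v -> (u \in S) || (v \in S).
Hypothesis S_dom : forall v : G, v \notin S -> exists2 u, u \in S & adj u v.

Let node := star {v : G | v \notin S}.

Definition star_bag (i : node) : {set G} :=
  if i is Some v then [set val v] else S.

Lemma star_bag_inj : injective star_bag.
Proof.
case=> [[u uS]|] [[v vS]|] //= e.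
- by move/set1_inj: e => e; congr Some; apply: val_inj.
- by case/negP: (uS); rewrite -e set11.
- by case/negP: (vS); rewrite e set11.
Qed.

Lemma mem_star_bag (v : G) : exists i : node, v \in star_bag i.
Proof.
have [vS|vS] := boolP (v \in S); first by exists None.
by exists (Some (exist _ v vS)); rewrite /= set11.
Qed.

Lemma star_bag_partition :
  partition [set star_bag i | i : node] [set: G].
Proof.
apply/and3P; split.
- apply/eqP/setP => v; rewrite inE; apply/bigcupP.
  have [i vi] := mem_star_bag v.
  by exists (star_bag i) => //; apply: imset_f.
- apply/trivIsetP => _ _ /imsetP[i _ ->] /imsetP[j _ ->] ne_ij.
  rewrite -setI_eq0; apply/eqP/setP => v; rewrite !inE; apply/negbTE.
  apply: contra ne_ij => /andP[].
  case: i j => [[a aS]|] [[b bS]|] //=; rewrite ?inE.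
  + by move=> /eqP-> /eqP->.
  + by move=> /eqP->; rewrite (negbTE aS).
  + by move=> vS /eqP ev; rewrite -ev vS in bS.
- apply/imsetP => -[[v|] _ /= e]; last by case/eqP: S_neq0.
  by move: (set11 (val v)); rewrite -e inE.
Qed.

Lemma star_bag_edge (u v : G) : adj u v ->
  exists i j : node, [/\ u \in star_bag i, v \in star_bag j & (i == j) || adj i j].
Proof.
move=> uv; have [uS|uS] := boolP (u \in S).
  have [vS|vS] := boolP (v \in S); first by exists None, None.
  by exists None, (Some (exist _ v vS)); split; rewrite //= set11.
have := S_cover uv; rewrite (negbTE uS) /= => vS.
by exists (Some (exist _ u uS)), None; split; rewrite //= set11.
Qed.

Definition star_std : strong_tree_decomp G :=
  StrongTreeDecomp (star_tree _) star_bag_inj star_bag_partition star_bag_edge.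

Lemma star_bag_parent (i j : td_tree star_std) (v : G) :
  is_parent (None : td_tree star_std) j i -> v \in bag star_std i ->
  exists2 u : G, u \in bag star_std j & adj u v.
Proof.
move=> /star_parent[]; case: i j => [[w wS]|] [j|] //= _ _.
by rewrite inE => /eqP->; apply: S_dom.
Qed.

Definition star_tdd : tree_distance_decomp G :=
  TreeDistanceDecomp star_bag_parent.

Lemma width_star_tdd : width star_tdd = #|S|.
Proof.
apply/eqP; rewrite eqn_leq; apply/andP; split.
  apply/bigmax_leqP => -[v|] _ //=.
  by rewrite cards1 card_gt0.
exact: (leq_bigmax (None : td_tree star_tdd)).
Qed.
End StarDecomposition.

(** * Bags of an arbitrary decomposition and a lower bound on its width *)

Lemma bag_cover (G : sgraph) (D : strong_tree_decomp G) (v : G) :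
  exists i, v \in bag D i.
Proof.
have /and3P[/eqP cov _ _] := bag_partition D.
have : v \in cover [set bag D i | i : td_tree D] by rewrite cov inE.
by case/bigcupP => _ /imsetP[i _ ->] vi; exists i.
Qed.

Lemma bag_uniq (G : sgraph) (D : strong_tree_decomp G) (v : G) i j :
  v \in bag D i -> v \in bag D j -> i = j.
Proof.
move=> vi vj; apply: (@bag_inj _ D).
have /and3P[_ tr _] := bag_partition D.
have in_bags l : bag D l \in [set bag D i | i : td_tree D] by apply: imset_f.
by rewrite -(def_pblock tr (in_bags i) vi) (def_pblock tr (in_bags j) vj).
Qed.

Lemma bag_adj (G : sgraph) (D : strong_tree_decomp G) (u v : G) i j :
  adj u v -> u \in bag D i -> v \in bag D j -> (i == j) || adj i j.
Proof.
move=> /(@bag_edge _ D)[i' [j' [ui' vj' ij]]] ui vj.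
by rewrite (bag_uniq ui ui') (bag_uniq vj vj').
Qed.

Lemma star_tdd_finest (G : sgraph) (S : {set G}) S0 Sc Sd :
  finest (@star_tdd G S S0 Sc Sd).
Proof.
move=> D' eS [v|] /=; last by exists (Defs.root D'); rewrite -/(root_bag D') eS.
have [j vj] := bag_cover D' (val v); exists j; by rewrite sub1set.
Qed.

(** If [b] and [b'] differed, they would close a triangle with [r] when [c] is one of them, and a
    4-cycle with [r] and [c] otherwise. *)
Lemma acyclic_diamond (T : sgraph) (r b b' c : T) : acyclic T -> r != c ->
  adj r b -> adj r b' -> (b == c) || adj b c -> (b' == c) || adj b' c -> b = b'.
Proof.
move=> acT rc rb rb' bc b'c; apply/eqP/negPn/negP => bb'.
have ne (x y : T) : adj x y -> x != y.
  by move=> xy; apply/eqP => e; rewrite e adj_irrefl in xy.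
have [ebc|nbc] := eqVneq b c.
  subst c; have b'b : adj b' b by rewrite eq_sym (negbTE bb') in b'c.
  suff : ucycle adj [:: r; b; b'] by move/acT.
  apply/andP; split; first by rewrite /= rb (adj_sym b) b'b (adj_sym b') rb'.
  by rewrite /= !inE negb_or rc bb' ne.
have {}bc : adj b c by rewrite (negbTE nbc) in bc.
have [eb'c|nb'c] := eqVneq b' c.
  subst c; suff : ucycle adj [:: r; b; b'] by move/acT.
  apply/andP; split; first by rewrite /= rb bc (adj_sym b') rb'.
  by rewrite /= !inE negb_or rc bb' ne.
have {}b'c : adj b' c by rewrite (negbTE nb'c) in b'c.
suff : ucycle adj [:: r; b; c; b'] by move/acT.
apply/andP; split; first by rewrite /= rb bc (adj_sym c) b'c (adj_sym b') rb'.
by rewrite /= !inE !negb_or rc bb' nbc (eq_sym c) nb'c !ne.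
Qed.

Lemma bag_le_width (G : sgraph) (D : strong_tree_decomp G) i :
  #|bag D i| <= width D.
Proof. exact: (leq_bigmax i). Qed.

(** All of [Y] lies in one bag: any bag meeting [Y] is adjacent to [r] and equal or adjacent to the
    bag of [c], so [acyclic_diamond] identifies any two of them. *)
Lemma fan_le_width (G : sgraph) (D : strong_tree_decomp G) (r : td_tree D)
    (c : G) (Y : {set G}) :
  c \notin bag D r ->
  (forall y, y \in Y -> adj y c) ->
  (forall y i, y \in Y -> y \in bag D i -> adj r i) ->
  #|Y| <= width D.
Proof.
move=> cr Yc Yr.
have [->|/set0Pn[y yY]] := eqVneq Y set0; first by rewrite cards0.
have [i yi] := bag_cover D y; have [l cl] := bag_cover D c.
apply: leq_trans (bag_le_width i).
apply/subset_leq_card/subsetP => z zY; have [j zj] := bag_cover D z.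
rewrite (@acyclic_diamond _ r i j l (td_treeP D).2) //.
- by apply: contraNneq cr => ->.
- exact: Yr yi.
- exact: Yr zj.
- exact: bag_adj (Yc y yY) yi cl.
- exact: bag_adj (Yc z zY) zj cl.
Qed.

(** * The chain graphs and their optimal root bags *)

Section Chain.
Variables q m : nat.

(* The consecutive vertices [inl g], [inl g.+1] of a chain have the [m] common
   neighbours [inr (g, a)]. *)
Definition chain_vertex : finType := ('I_q.+1 + 'I_q * 'I_m)%type.

(** Joints get even levels and layer vertices odd ones, which turns adjacency into arithmetic for
    [lia]. *)
Definition level (u : chain_vertex) : nat :=
  match u with inl j => j.*2 | inr x => (x.1 : nat).*2.+1 end.

Definition chain_adj : rel chain_vertex :=
  [rel u v | (level u == (level v).+1) || (level v == (level u).+1)].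

Lemma chain_adj_sym : symmetric chain_adj.
Proof. by move=> u v; rewrite /chain_adj /= orbC. Qed.

Lemma chain_adj_irrefl : irreflexive chain_adj.
Proof. by move=> u; rewrite /chain_adj /=; lia. Qed.

Definition chain : sgraph := SGraph chain_adj_sym chain_adj_irrefl.

Lemma card_chain : #|chain| = q.+1 + q * m.
Proof. by rewrite card_sum card_prod !card_ord. Qed.

(** Natural indices allow [g] and [g.+1] side by side; beyond [q], [inord] falls back to 0, hence
    the bounds [j <= q] below. *)
Definition joint (j : nat) : chain := inl (inord j).

Lemma level_joint j : j <= q -> level (joint j) = j.*2.
Proof. by move=> jq; rewrite /= inordK. Qed.

Definition layer (g : 'I_q) : {set chain} := [set inr (g, a) | a : 'I_m].

Lemma card_layer g : #|layer g| = m.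
Proof. by rewrite card_imset ?card_ord // => a b []. Qed.

Lemma layer_adj (g : 'I_q) (j : nat) (y : chain) :
  (j == g) || (j == g.+1) -> y \in layer g -> adj y (joint j).
Proof.
move=> jg /imsetP[a _ ->]; have gq := ltn_ord g.
rewrite /adj /= /chain_adj /=; rewrite inordK; lia.
Qed.

Definition selection (h : {ffun 'I_q -> 'I_m}) : {set chain} :=
  [set u : chain | if u is inr x then x.2 == h x.1 else true].

Lemma selection_inj : injective selection.
Proof.
move=> h h' e; apply/ffunP => g; apply/eqP.
have : (inr (g, h g) : chain) \in selection h' by rewrite -e inE /=.
by rewrite inE.
Qed.

Lemma card_selection h : #|selection h| = q.*2.+1.
Proof.
have -> : selection h = [set inl j | j : 'I_q.+1] :|: [set inr (g, h g) | g : 'I_q].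
  apply/setP => -[j|[g a]]; rewrite !inE /=.
    by rewrite imset_f.
  apply/eqP/idP => [->|]; first by rewrite [X in _ || X]imset_f ?orbT.
  by case/orP => /imsetP[x _] // [-> ->].
rewrite cardsU (_ : _ :&: _ = set0) ?cards0 ?subn0; last first.
  apply/setP => u; rewrite !inE; apply/negbTE/negP => /andP[/imsetP[j _ ->]].
  by case/imsetP.
rewrite !card_imset ?card_ord //; [lia | by move=> x y [] | by move=> x y []].
Qed.

(** Only layer vertices are left out, and their odd levels are never consecutive. *)
Lemma selection_cover h (u v : chain) :
  adj u v -> (u \in selection h) || (v \in selection h).
Proof. by case: u v => [i|x] [j|y]; rewrite /adj /= /chain_adj !inE //=; lia. Qed.

Lemma joint_selection h j : joint j \in selection h.
Proof. by rewrite inE. Qed.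

Lemma selection_dom h (v : chain) :
  v \notin selection h -> exists2 u, u \in selection h & adj u v.
Proof.
case: v => [j|[g a]]; first by rewrite inE.
exists (joint g); first exact: joint_selection.
by rewrite adj_sym; apply: (@layer_adj g); rewrite ?eqxx // imset_f.
Qed.

Lemma selection_neq0 h : selection h != set0.
Proof. by apply/set0Pn; exists (joint 0); apply: joint_selection. Qed.

Definition selection_tdd h : tree_distance_decomp chain :=
  star_tdd (selection_neq0 h) (@selection_cover h) (@selection_dom h).

Lemma width_selection_tdd h : width (selection_tdd h) = q.*2.+1.
Proof. by rewrite width_star_tdd card_selection. Qed.

Lemma selection_tdw h : is_tdw (selection h) (Some q.*2.+1).
Proof.
by rewrite -(width_selection_tdd h); apply: Tdw_finite => //; apply: star_tdd_finest.
Qed.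

(** The selected vertex of layer [g] links joints [g] and [g.+1], so everything is reached from
    joint 0. *)
Lemma selection_connected h : connected_set (selection h).
Proof.
rewrite /connected_set selection_neq0 /=.
set e := [rel u v | _]; have e_sym : connect_sym e.
  apply: sym_connect_sym => u v; rewrite /e /= chain_adj_sym.
  by case: (u \in _); case: (v \in _).
have to_joint (g : 'I_q) (j : nat) : (j == g) || (j == g.+1) ->
    e (inr (g, h g)) (joint j).
  move=> jg; rewrite /e /= joint_selection inE eqxx /=.
  by apply: (@layer_adj g); rewrite // imset_f.
have joint0 j : j <= q -> connect e (joint 0) (joint j).
  elim: j => [|j IH] jq; first exact: connect0.
  apply: (connect_trans (IH (ltnW jq))).
  apply: (@connect_trans _ _ (inr (Ordinal jq, h (Ordinal jq)))).
    by rewrite e_sym; apply/connect1/to_joint; rewrite eqxx.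
  by apply/connect1/to_joint; rewrite eqxx orbT.
suff sel0 u : u \in selection h -> connect e (joint 0) u.
  apply/forall_inP => u /sel0 u0; apply/forall_inP => v /sel0 v0.
  by rewrite e_sym in u0; apply: connect_trans u0 v0.
case: u => [j _|[g a]].
  by rewrite -[j]inord_val; apply: joint0; rewrite -ltnS.
rewrite inE /= => /eqP->; apply: (connect_trans (joint0 g (ltnW (ltn_ord g)))).
by rewrite e_sym; apply/connect1/to_joint; rewrite eqxx.
Qed.

(** * Connected root bags: all joints, none, or some *)

Lemma selection_sub (S : {set chain}) :
  connected_set S -> (forall j, j <= q -> joint j \in S) ->
  exists h, selection h \subset S.
Proof.
case/andP=> _ /forall_inP conS jS.
have ex (g : 'I_q) : exists a : 'I_m, (inr (g, a) : chain) \in S.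
  have gq := ltn_ord g.
  apply/existsP; apply: contraT; rewrite negb_exists => /forallP none.
  have /forall_inP/(_ _ (jS g.+1 gq)) := conS _ (jS g (ltnW gq)).
  (* If [S] missed layer [g], a walk in [S] from joint [g] could never leave [low], since levels
     change by one and level [g.*2.+1] is exactly that layer. *)
  set e := [rel u v | _]; pose low := [pred u : chain | level u <= g.*2].
  have step u v : e u v -> u \in low -> v \in low.
    case/and3P => _ vS; rewrite /adj /= /chain_adj /= !inE => uv ul.
    have : level v != g.*2.+1.
      case: v vS {uv} => [j _|[g' a] vS] /=; first by lia.
      apply: contraTneq vS => eg.
      have -> : g' = g by apply: val_inj => /=; lia.
      exact: none.
    lia.
  case/connectP => s; rewrite -/e => se ls.
  have : last (joint g) s \in low.
    have : joint g \in low by rewrite inE level_joint // ltnW.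
    elim: s (joint g) se {ls} => [|v s IH] u //= /andP[uv vs] ul.
    exact: IH vs (step _ _ uv ul).
  by rewrite -ls inE level_joint //; lia.
exists [ffun g => xchoose (ex g)]; apply/subsetP => -[j _|[g a]].
  by rewrite -[j]inord_val; apply: jS; rewrite -ltnS.
by rewrite inE ffunE /= => /eqP->; exact: (xchooseP (ex g)).
Qed.

(** Layer vertices are pairwise nonadjacent, so a path avoiding the joints has no edge. *)
Lemma connected_set_no_joint (S : {set chain}) : connected_set S ->
  (forall j, j <= q -> joint j \notin S) -> exists x, S = [set inr x].
Proof.
case/andP=> /set0Pn[u uS] /forall_inP conS jS.
have inlS j : (inl j : chain) \notin S.
  by rewrite -[j]inord_val; apply: jS; rewrite -ltnS.
case: u uS => [j|x] xS; first by rewrite (negbTE (inlS j)) in xS.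
exists x; apply/setP => v; rewrite inE; apply/idP/eqP => [vS|->] //.
have /forall_inP/(_ _ vS)/connectP[[|y s] //=] := conS _ xS.
case/andP=> /and3P[_ yS xy] _ _; exfalso.
case: y yS xy => [j|y]; first by rewrite (negbTE (inlS j)).
by move=> _; rewrite /adj /= /chain_adj /=; lia.
Qed.

(** The root bag contains one part of layer [g]; the rest is a fan between the root and joint [j].
    One of the two has at least half of the [m] vertices. *)
Lemma mixed_width (D : tree_distance_decomp chain) (g : 'I_q) (i j : nat) :
  (i == g) || (i == g.+1) -> (j == g) || (j == g.+1) ->
  joint i \in root_bag D -> joint j \notin root_bag D -> m <= (width D).*2.
Proof.
move=> ig jg iS jS.
have le1 : #|layer g :&: root_bag D| <= width D.
  by apply: leq_trans (bag_le_width (Defs.root D)); apply/subset_leq_card/subsetIr.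
have le2 : #|layer g :\: root_bag D| <= width D.
  apply: (fan_le_width jS) => [y|y l].
    by rewrite inE => /andP[_]; apply: layer_adj.
  rewrite inE => /andP[yS /(layer_adj ig) yi] yl.
  have := bag_adj yi yl iS; case/orP => [/eqP el|]; last by rewrite adj_sym.
  by rewrite -/(root_bag D) /root_bag -el yl in yS.
by have := cardsID (root_bag D) (layer g); rewrite card_layer; lia.
Qed.

Lemma singleton_width (D : tree_distance_decomp chain) x :
  1 < q -> root_bag D = [set inr x] -> m <= width D.
Proof.
case: x => g a q1 rD; have gq := ltn_ord g.
(* Layer [g'] is next to layer [g], [c] is the joint they share and [f] the far joint of [g']. *)
have [g' [c [f [cx fx cg' fg' [cq fq]]]]] : exists (g' : 'I_q) (c f : nat),
    [/\ (c == g) || (c == g.+1), f != g /\ f != g.+1,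
        (c == g') || (c == g'.+1), (f == g') || (f == g'.+1) &
        c <= q /\ f <= q].
  have [lt|ge] := ltnP g.+1 q.
    by exists (Ordinal lt), g.+1, g.+2; split => /=; lia.
  have lt : g.-1 < q by lia.
  by exists (Ordinal lt), g, g.-1; split => /=; lia.
have [b cb] := bag_cover D (joint c).
have xroot : (inr (g, a) : chain) \in bag D (Defs.root D).
  by rewrite -/(root_bag D) rD set11.
have xc : adj (inr (g, a) : chain) (joint c).
  by apply: layer_adj cx _; rewrite imset_f.
have rb : adj (Defs.root D) b.
  have /orP[/eqP eb|//] := bag_adj xc xroot cb.
  by move: cb; rewrite -eb -/(root_bag D) rD inE.
(* The node [b] is a child of the root, so its bag holds only neighbours of the single root vertex:
   neither [f] nor any vertex of layer [g']. *)
have near v : v \in bag D b -> adj (inr (g, a) : chain) v.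
  have par : is_parent (Defs.root D) (Defs.root D) b.
    exists [::]; rewrite /= inE rb; split=> //; rewrite andbT.
    by apply: contraTneq rb => <-; rewrite adj_irrefl.
  move=> /(bag_parent par)[u]; rewrite -/(root_bag D) rD inE => /eqP-> //.
rewrite -(card_layer g'); apply: (@fan_le_width _ D b (joint f)).
- apply/negP => /near; rewrite /adj /= /chain_adj /= inordK //; lia.
- by move=> y; apply: layer_adj.
- move=> y i yg yi; have := bag_adj (layer_adj cg' yg) yi cb.
  case/orP => [/eqP ei|]; last by rewrite adj_sym.
  subst i; move: (near y yi); case/imsetP: yg => a' _ ->.
  by rewrite /adj /= /chain_adj /=; lia.
Qed.

Lemma selection_or_wide (D : tree_distance_decomp chain) :
  1 < q -> connected_set (root_bag D) ->
  (exists h, selection h \subset root_bag D) \/ m <= (width D).*2.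
Proof.
move=> q1 con.
(* Unless consecutive joints always agree on membership in the root bag, some layer is mixed. *)
have [/forallP same|] := boolP [forall g : 'I_q,
    (joint g \in root_bag D) == (joint g.+1 \in root_bag D)]; last first.
  rewrite negb_forall => /existsP[g ne]; right.
  have [gS|gS] := boolP (joint g \in root_bag D).
    apply: (@mixed_width D g g g.+1); rewrite ?eqxx ?orbT //.
    by rewrite gS in ne; case: (_ \in _) ne.
  apply: (@mixed_width D g g.+1 g); rewrite ?eqxx ?orbT //.
  by rewrite (negbTE gS) in ne; case: (_ \in _) ne.
have {}same j : j <= q -> (joint j \in root_bag D) = (joint 0 \in root_bag D).
  elim: j => [//|j IH] jq.
  by rewrite -IH ?(ltnW jq) //; have /eqP-> := same (Ordinal jq).
have [S0|S0] := boolP (joint 0 \in root_bag D).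
  by left; apply: selection_sub => // j /same->.
right; have [|x rD] := connected_set_no_joint con.
  by move=> j /same->.
by have := singleton_width q1 rD; lia.
Qed.

(** * The value of ctdw and the count of optimal connected sets *)

Hypothesis q_gt1 : 1 < q.
(** Makes [m <= (width D).*2] force width at least [q.*2.+2], one more than a selection achieves. *)
Hypothesis m_large : 4 * q.+1 <= m.

Lemma chain_ctdw : is_ctdw chain q.*2.+1.
Proof.
have a0 : 0 < m by lia.
split.
  exists (selection_tdd [ffun=> Ordinal a0]); last exact: width_selection_tdd.
  exact: selection_connected.
move=> D /(selection_or_wide q_gt1)[[h hS]|]; last by lia.
rewrite -(card_selection h); apply: leq_trans (subset_leq_card hS) _.
exact: bag_le_width.
Qed.

Lemma chain_tdw_sets :
  [set S : {set chain} | connected_set S && `[< is_tdw S (Some q.*2.+1) >]]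
  = [set selection h | h : {ffun 'I_q -> 'I_m}].
Proof.
apply/setP => S; rewrite inE; apply/andP/imsetP => [[con]|[h _ ->]]; last first.
  by split; [apply: selection_connected | apply/asboolP/selection_tdw].
move/asboolP => tdw; inversion tdw as [D rD _ wD|].
move: con; rewrite -rD => /(selection_or_wide q_gt1)[[h hS]|]; last by lia.
(* The root bag contains a selection and its size is at most the width, which is the size of that
   selection. *)
exists h => //; apply/esym/eqP; rewrite eqEcard hS card_selection -wD.
exact: bag_le_width.
Qed.
End Chain.

Lemma isomorphic_card (G H : sgraph) : isomorphic G H -> #|G| = #|H|.
Proof. by case=> f /bij_eq_card. Qed.

Theorem theorem4 (k : nat) (hk : 3 <= k) :
  exists F : nat -> sgraph,
    (forall i j : nat, isomorphic (F i) (F j) -> i = j) /\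
    (forall i : nat,
       is_ctdw (F i) (2 * k - 1) /\
       (#|[set S : {set F i} | connected_set S &&
                               `[< is_tdw S (Some (2 * k - 1)%N) >]]|%:R
        = ((#|F i|%:R - k%:R) / (k%:R - 1)) ^+ (k - 1)%N :> rat)%R).
Proof.
(* Here [k] is [q.+1]; distinct [i] give distinct layer sizes, hence distinct vertex counts. *)
case: k hk => // q q_gt1; exists (fun i => chain q (4 * q.+1 + i)); split.
  move=> i j /isomorphic_card; rewrite !card_chain => /addnI/eqP.
  by rewrite eqn_pmul2l => [/eqP/addnI //|]; lia.
move=> i; have -> : 2 * q.+1 - 1 = q.*2.+1 by lia.
rewrite subn1 /=; split; first by apply: chain_ctdw; lia.
rewrite chain_tdw_sets; [|lia|lia].
rewrite card_imset; last exact: selection_inj.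
(* There are [m ^ q] selections, and [n - k] is [q * m], so dividing by [k - 1], which is [q],
   leaves [m]. *)
rewrite card_ffun !card_ord card_chain -natrB ?leq_addr // addKn.
rewrite -natr1 addrK natrM [(q%:R * _)%R]mulrC mulfK ?natrX //.
by rewrite Num.Theory.pnatr_eq0; lia.
Qed.
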